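(* Let $F:\mathbb{R}^n\to\mathbb{R}^n$, $x_{k-1},x_k\in\mathbb{R}^n$, $F_k=F(x_k)$, $J_k=J(x_k)$, let $\beta_k\in\mathbb{R}$ be a nonzero steplength, $\gamma_k\in(0,1]$ and $\eta_k>0$. Suppose that the scalars $$\beta_{k,1}=\frac{p_{k-1}^Tp_{k-1}}{p_{k-1}^Ty_{k-1}},\qquad \beta_{k,2}=\frac{p_{k-1}^Ty_{k-1}}{y_{k-1}^Ty_{k-1}},\qquad p_{k-1}=x_k-x_{k-1},\quad y_{k-1}=F(x_k)-F(x_{k-1}),$$ are well defined and nonzero. Let $p_k$ be the step specified in each item below, let $x_{k+1}=x_k+p_k$, $F_{k+1}=F(x_{k+1})$, and suppose that $F$ is continuously differentiable in an open convex set $D\subset\mathbb{R}^n$ containing $x_k+t\,p_k$ for all $t\in[0,1]$. Suppose $F_k^TJ_kF_k\neq0$ and $F_k^TG_kF_k\neq0$, where $G_k=\int_0^1J(x_k+t\,p_k)\,dt$. Let $$\Delta=q\big((G_S)_k,F_k\big)^2+(\eta_k^2+2\eta_k)\,q(G_k^TG_k,F_k).$$ (1) If $p_k=-\gamma_k\beta_kF_k$, then $\|F_{k+1}\|<\|F_k\|$ when $$\beta_k\,q\big((G_S)_k,F_k\big)>0\quad\text{and}\quad \gamma_k|\beta_k|<2\,\frac{\big|q\big((G_S)_k,F_k\big)\big|}{q(G_k^TG_k,F_k)}.$$ The condition $\|F_{k+1}\|\le(1+\eta_k)\|F_k\|$ is satisfied when $$\frac{q\big((G_S)_k,F_k\big)-\sqrt{\Delta}}{q(G_k^TG_k,F_k)}\le\gamma_k\beta_k\le\frac{q\big((G_S)_k,F_k\big)+\sqrt{\Delta}}{q(G_k^TG_k,F_k)}.$$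 (2) If $p_k=\gamma_k\beta_kF_k$, then $\|F_{k+1}\|<\|F_k\|$ when $$\beta_k\,q\big((G_S)_k,F_k\big)<0\quad\text{and}\quad \gamma_k|\beta_k|<2\,\frac{\big|q\big((G_S)_k,F_k\big)\big|}{q(G_k^TG_k,F_k)}.$$ The condition $\|F_{k+1}\|\le(1+\eta_k)\|F_k\|$ is satisfied when $$\frac{-q\big((G_S)_k,F_k\big)-\sqrt{\Delta}}{q(G_k^TG_k,F_k)}\le\gamma_k\beta_k\le\frac{-q\big((G_S)_k,F_k\big)+\sqrt{\Delta}}{q(G_k^TG_k,F_k)}.$$
   Context: $\|\cdot\|$ is the Euclidean norm and $J$ is the Jacobian matrix of $F$. For a square matrix $A$, $A_S=\frac12(A+A^T)$ is its symmetric part (so $J_S$ is the symmetric part of $J$), and $(G_S)_k=\int_0^1J_S(x_k+t\,p_k)\,dt$. For a symmetric matrix $M$ and nonzero vector $p$, $q(M,p)=\dfrac{p^TMp}{p^Tp}$ is the Rayleigh quotient. In each item the matrices $G_k$ and $(G_S)_k$ are those associated with the step $p_k$ of that item. *)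

(* Defs.v *)
From mathcomp Require Import all_boot all_order all_algebra.
From mathcomp Require Import all_classical all_reals all_analysis.
Import Order.TTheory GRing.Theory Num.Theory.
Import numFieldNormedType.Exports.

Set Implicit Arguments.
Unset Strict Implicit.
Unset Printing Implicit Defensive.

Local Open Scope classical_set_scope.
Local Open Scope ring_scope.

(* Vectors of R^n are row vectors 'rV[R]_n, as required by the library's
   [jacobian]; so u^T v is u *m v^T and u^T M u is u *m M *m u^T. *)

Definition dotv (R : realType) n (u v : 'rV[R]_n) : R := (u *m v^T) 0 0.

(* The norm `|u| that the library puts on 'rV[R]_n is the maximum norm. *)
Definition enorm (R : realType) n (u : 'rV[R]_n) : R := Num.sqrt (dotv u u).

Definition quadform (R : realType) n (M : 'M[R]_n) (u : 'rV[R]_n) : R :=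
  (u *m M *m u^T) 0 0.

Definition rayleigh (R : realType) n (M : 'M[R]_n) (u : 'rV[R]_n) : R :=
  quadform M u / dotv u u.

Definition sympart (R : realType) n (A : 'M[R]_n) : 'M[R]_n :=
  2^-1 *: (A + A^T).

(* The library's [jacobian F x] represents the differential as v |-> v *m A,
   hence is the transpose of the usual matrix (dF_i / dx_j)_(i, j). *)
Definition jacmx (R : realType) n (F : 'rV[R]_n -> 'rV[R]_n) (x : 'rV[R]_n) :
    'M[R]_n :=
  (jacobian F x)^T.

Definition continuously_differentiable_on (R : realType) n
    (F : 'rV[R]_n -> 'rV[R]_n) (D : set 'rV[R]_n) : Prop :=
  (forall x, D x -> differentiable F x) /\ {within D, continuous (jacmx F)}.

Definition intmx01 (R : realType) n (A : R -> 'M[R]_n) : 'M[R]_n :=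
  \matrix_(i, j) \int[@lebesgue_measure R]_(t in `[0%R, 1%R]) (A t i j).

Definition avgjac (R : realType) n (F : 'rV[R]_n -> 'rV[R]_n)
    (x p : 'rV[R]_n) : 'M[R]_n :=
  intmx01 (fun t => jacmx F (x + t *: p)).

Definition avgjacS (R : realType) n (F : 'rV[R]_n -> 'rV[R]_n)
    (x p : 'rV[R]_n) : 'M[R]_n :=
  intmx01 (fun t => sympart (jacmx F (x + t *: p))).

(* Barzilai-Borwein steplengths *)
Definition bb1 (R : realType) n (p y : 'rV[R]_n) : R := dotv p p / dotv p y.
Definition bb2 (R : realType) n (p y : 'rV[R]_n) : R := dotv p y / dotv y y.

(* Main.v *)
Require Import Defs.
From mathcomp Require Import all_boot all_order all_algebra.
From mathcomp Require Import all_classical all_reals all_analysis.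
From mathcomp Require Import ring lra.
Import Order.TTheory GRing.Theory Num.Theory.
Import numFieldNormedType.Exports.
Local Open Scope classical_set_scope.
Local Open Scope ring_scope.

(** Along the segment from x to x + p the fundamental theorem of calculus gives
    F (x + p) - F x = G p, with G the average of the Jacobian over the segment
    ([mean_value_avgjac]).  For p = - a F(x) the new residual is therefore
    (I - a G) F(x), so that, writing u for F(x),
      |F (x + p)|^2 = |u|^2 - 2 a u^T G u + a^2 |G u|^2
                    = |u|^2 (1 - 2 a s + a^2 g),
    where s is the Rayleigh quotient at u of the symmetric part of G (a quadratic
    form only sees the symmetric part of its matrix, and taking the symmetric
    part commutes with averaging, [avgjacS_sympart]) and g > 0 is that of G^T G.

    Everything is then a statement on the parabola a^2 g - 2 a s in a.  It is
    negative strictly between its roots 0 and 2 s / g ([quadratic_lt0]), which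
    gives the decrease of the norm; and it stays below
    (1 + eta)^2 - 1 = eta^2 + 2 eta between the two roots of
    a^2 g - 2 a s = eta^2 + 2 eta, whose reduced discriminant is Delta
    ([quadratic_le]), which gives the approximate decrease.  The two signs of the
    step are the cases a = gamma beta and a = - gamma beta of the same result,
    [residual_bounds]. *)

(** * Integrals of continuous functions on the unit interval *)

Set Implicit Arguments.
Unset Strict Implicit.

Lemma within_continuous_sum (R : realType) (I : Type) (s : seq I)
    (f : I -> R -> R) (A : set R) :
  (forall i, {within A, continuous (f i)}) ->
  {within A, continuous (fun t => \sum_(i <- s) f i t)}.
Proof.
move=> fc; elim: s => [|i s IHs].
  under eq_fun do rewrite big_nil.
  by move=> t; exact: cvg_cst.
under eq_fun do rewrite big_cons.
by move=> t; apply: cvgD; [exact: fc | exact: IHs].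
Qed.

Lemma within_continuousMl (R : realType) (c : R) (f : R -> R) (A : set R) :
  {within A, continuous f} -> {within A, continuous (fun t => c * f t)}.
Proof. by move=> fc t; apply: cvgM; [exact: cvg_cst | exact: fc]. Qed.

Lemma within_continuous_integrable01 (R : realType) (f : R -> R) :
  {within `[0, 1], continuous f} ->
  (@lebesgue_measure R).-integrable `[0, 1] (EFin \o f).
Proof.
move=> fc; apply: continuous_compact_integrable => //.
exact: segment_compact.
Qed.

Lemma Rintegral01_sum (R : realType) (I : Type) (s : seq I) (f : I -> R -> R) :
  (forall i, {within `[0, 1], continuous (f i)}) ->
  \int[@lebesgue_measure R]_(t in `[0, 1]) (\sum_(i <- s) f i t) =
  \sum_(i <- s) \int[@lebesgue_measure R]_(t in `[0, 1]) f i t.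
Proof.
move=> fc; elim: s => [|i s IHs].
  rewrite big_nil; under eq_Rintegral do rewrite big_nil.
  by rewrite Rintegral_cst// mul0r.
rewrite big_cons -IHs; under eq_Rintegral do rewrite big_cons.
apply: RintegralD => //; apply: within_continuous_integrable01 => //.
exact: within_continuous_sum.
Qed.

(** * The averaged Jacobian along a segment *)

(** The difference quotient of s |-> F (x + s p) at t is literally that of F at
    x + t p in the direction p, whose limit is the directional derivative;
    coordinates pass to the limit by continuity. *)
Lemma is_derive_line (R : realType) n (F : 'rV[R]_n -> 'rV[R]_n)
    (x p : 'rV[R]_n) (t : R) (i : 'I_n) :
  differentiable F (x + t *: p) ->
  is_derive t 1 (fun s : R => F (x + s *: p) 0 i)
    ((p *m jacobian F (x + t *: p)) 0 i).
Proof.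
move=> dF.
have dv : derivable F (x + t *: p) p by exact: diff_derivable.
have := cvg_comp _ _ dv (@coord_continuous R 1 n 0 i _).
rewrite -/(derive _ _ _) deriveEjacobian// => cv.
have cv' : h^-1 *: ((fun s : R => F (x + s *: p) 0 i) (h *: 1 + t)
     - F (x + t *: p) 0 i) @[h --> 0^'] --> (p *m jacobian F (x + t *: p)) 0 i.
  apply: cvg_trans cv; apply: near_eq_cvg; near=> h => /=.
  by rewrite !mxE scalerDl /GRing.scale /= mulr1 addrCA.
split; first by apply/cvg_ex; eexists; exact: cv'.
exact: cvg_lim.
Unshelve. all: by end_near. Qed.

(** As D is open, the Jacobian is continuous at every point of D in the full
    topology, and so is its composition with the affine path as long as the
    latter stays in D. *)
Lemma within_continuous_jacmx_line (R : realType) n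
    (F : 'rV[R]_n -> 'rV[R]_n) (D : set 'rV[R]_n) (x p : 'rV[R]_n) i j :
  open D -> (forall t : R, 0 <= t <= 1 -> D (x + t *: p)) ->
  {within D, continuous (jacmx F)} ->
  {within `[0, 1], continuous (fun t : R => jacmx F (x + t *: p) i j)}.
Proof.
move=> oD segD; rewrite continuous_open_subspace// => cJ.
apply: continuous_in_subspaceT => t; rewrite inE/= in_itv/= => t01.
have line_cvg : (x + s *: p) @[s --> t] --> x + t *: p.
  by apply: cvgD; [exact: cvg_cst | apply: cvgZr_tmp; exact: cvg_id].
have cJt : {for x + t *: p, continuous (jacmx F)}.
  by apply: cJ; rewrite inE; exact: segD.
have J_cvg := cvg_comp _ _ line_cvg cJt.
exact: cvg_comp _ _ J_cvg (@coord_continuous R n n i j _).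
Qed.

(** The integral mean value theorem for vector fields: the fundamental theorem
    of calculus is applied to each coordinate of s |-> F (x + s p), and the
    integral is then exchanged with the finite sum of the matrix product.
    Vectors are rows, hence the transpose. *)
Lemma mean_value_avgjac (R : realType) n (F : 'rV[R]_n -> 'rV[R]_n)
    (D : set 'rV[R]_n) (x p : 'rV[R]_n) :
  open D -> (forall t : R, 0 <= t <= 1 -> D (x + t *: p)) ->
  continuously_differentiable_on F D ->
  F (x + p) - F x = p *m (avgjac F x p)^T.
Proof.
move=> oD segD [dF cJ]; apply/rowP => i.
have J01 j : {within `[0, 1],
    continuous (fun t : R => jacmx F (x + t *: p) i j)}.
  exact: within_continuous_jacmx_line oD segD cJ.
have dline (t : R) : 0 <= t <= 1 ->
    is_derive t (1 : R) (fun s : R => F (x + s *: p) 0 i)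
    (\sum_j p 0 j * jacmx F (x + t *: p) i j).
  have -> : \sum_j p 0 j * jacmx F (x + t *: p) i j =
      (p *m jacobian F (x + t *: p)) 0 i.
    by rewrite mxE; apply: eq_bigr => j _; rewrite mxE.
  by move=> /segD/dF dFt; exact: is_derive_line.
have pJ01 j : {within `[0, 1],
    continuous (fun t : R => p 0 j * jacmx F (x + t *: p) i j)}.
  exact: within_continuousMl.
have line_cont (t : R) : 0 <= t <= 1 ->
    {for t, continuous (fun s : R => F (x + s *: p) 0 i)}.
  move=> /dline dlt; apply/differentiable_continuous/derivable1_diffP.
  exact: ex_derive.
have FTC : \int[@lebesgue_measure R]_(t in `[0, 1])
    (\sum_j p 0 j * jacmx F (x + t *: p) i j) = F (x + p) 0 i - F x 0 i.
  have := @continuous_FTC2 R (fun t => \sum_j p 0 j * jacmx F (x + t *: p) i j)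
    (fun t => F (x + t *: p) 0 i) 0 1 ltr01.
  rewrite /Rintegral => ->.
  - by rewrite /= scale1r scale0r addr0.
  - exact: within_continuous_sum.
  - split.
    + move=> t; rewrite in_itv/= => /andP[t0 t1].
      by have /dline dlt : 0 <= t <= 1 by rewrite !ltW//; exact: ex_derive.
    + by apply: cvg_at_right_filter; apply: line_cont; rewrite lexx ler01.
    + by apply: cvg_at_left_filter; apply: line_cont; rewrite lexx ler01.
  - move=> t; rewrite in_itv/= => /andP[t0 t1].
    have /dline dlt : 0 <= t <= 1 by rewrite !ltW.
    by rewrite derive1E; exact: derive_val.
rewrite !mxE -FTC Rintegral01_sum//; apply: eq_bigr => j _.
by rewrite !mxE RintegralZl//; exact: within_continuous_integrable01.
Qed.

Lemma sympartE (R : realType) n (A : 'M[R]_n) i j :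
  sympart A i j = 2^-1 * (A i j + A j i).
Proof. by rewrite !mxE. Qed.

Lemma intmx01E (R : realType) n (A : R -> 'M[R]_n) i j :
  intmx01 A i j = \int[@lebesgue_measure R]_(t in `[0, 1]) A t i j.
Proof. by rewrite mxE. Qed.

(** Splitting the integral of a sum needs both terms to be integrable, which is
    where the continuity of the Jacobian along the segment enters. *)
Lemma avgjacS_sympart (R : realType) n (F : 'rV[R]_n -> 'rV[R]_n)
    (D : set 'rV[R]_n) (x p : 'rV[R]_n) :
  open D -> (forall t : R, 0 <= t <= 1 -> D (x + t *: p)) ->
  {within D, continuous (jacmx F)} ->
  avgjacS F x p = sympart (avgjac F x p).
Proof.
move=> oD segD cJ; apply/matrixP => i j; rewrite sympartE !intmx01E.
have J01 k l : {within `[0, 1],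
    continuous (fun t : R => jacmx F (x + t *: p) k l)}.
  exact: within_continuous_jacmx_line oD segD cJ.
have iJ k l := within_continuous_integrable01 (J01 k l).
under eq_Rintegral do rewrite sympartE mulrDr.
rewrite RintegralD//; first by rewrite !RintegralZl// -mulrDr.
all: by apply: within_continuous_integrable01; exact: within_continuousMl.
Qed.

(** * Quadratic forms *)

Lemma dotvE (R : realType) n (u v : 'rV[R]_n) :
  dotv u v = \sum_i u 0 i * v 0 i.
Proof. by rewrite /dotv mxE; apply: eq_bigr => i _; rewrite mxE. Qed.

Lemma dotv_ge0 (R : realType) n (u : 'rV[R]_n) : 0 <= dotv u u.
Proof. by rewrite dotvE sumr_ge0// => i _; rewrite -expr2 sqr_ge0. Qed.

Lemma dotv_eq0 (R : realType) n (u : 'rV[R]_n) : dotv u u = 0 -> u = 0.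
Proof.
rewrite dotvE => /eqP; rewrite psumr_eq0; last first.
  by move=> i _; rewrite -expr2 sqr_ge0.
move=> /allP u0; apply/rowP => i; rewrite mxE.
by have := u0 i (mem_index_enum i); rewrite /= -expr2 sqrf_eq0 => /eqP.
Qed.

(** A 1 x 1 matrix is its own transpose. *)
Lemma quadform_tr (R : realType) n (M : 'M[R]_n) (u : 'rV[R]_n) :
  quadform M^T u = quadform M u.
Proof.
have -> : quadform M^T u = (u *m M^T *m u^T)^T 0 0 by rewrite mxE.
by rewrite /quadform !trmx_mul !trmxK mulmxA.
Qed.

Lemma quadform_sympart (R : realType) n (M : 'M[R]_n) (u : 'rV[R]_n) :
  quadform (sympart M) u = quadform M u.
Proof.
have -> : quadform (sympart M) u = 2^-1 * (quadform M u + quadform M^T u).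
  by rewrite /quadform /sympart -scalemxAr -scalemxAl mulmxDr mulmxDl !mxE.
by rewrite quadform_tr; field.
Qed.

Lemma quadform_gram (R : realType) n (M : 'M[R]_n) (u : 'rV[R]_n) :
  quadform (M^T *m M) u = dotv (u *m M^T) (u *m M^T).
Proof. by rewrite /quadform /dotv trmx_mul trmxK !mulmxA. Qed.

Lemma dotv_mul_tr (R : realType) n (M : 'M[R]_n) (u : 'rV[R]_n) :
  dotv (u *m M^T) u = quadform M u.
Proof. by rewrite /dotv -/(quadform _ _) quadform_tr. Qed.

Lemma dotv_subZ (R : realType) n (a : R) (u w : 'rV[R]_n) :
  dotv (u - a *: w) (u - a *: w) =
  dotv u u - 2 * a * dotv w u + a ^+ 2 * dotv w w.
Proof.
rewrite !dotvE !mulr_sumr -sumrB -big_split/=.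
by apply: eq_bigr => i _; rewrite !mxE; ring.
Qed.

(** * The residual as a parabola in the steplength *)

(** Multiplying the bound on |a| by |a| gives a^2 g < 2 |a| |s|, and the sign
    condition turns |a| |s| into a s. *)
Lemma quadratic_lt0 (R : realType) (a s g : R) : 0 < g ->
  0 < a * s -> `|a| < 2 * (`|s| / g) -> a ^+ 2 * g - 2 * a * s < 0.
Proof.
move=> g0 as0; rewrite mulrA ltr_pdivlMr// => ag.
have a0 : 0 < `|a|.
  by rewrite normr_gt0; apply: contraTneq as0 => ->; rewrite mul0r ltxx.
have : `|a| * (`|a| * g) < `|a| * (2 * `|s|) by rewrite ltr_pM2l.
have -> : `|a| * (2 * `|s|) = 2 * (a * s).
  by rewrite -(gtr0_norm as0) normrM; ring.
by rewrite -[a ^+ 2]real_normK ?num_real//; lra.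
Qed.

(** Completing the square, the bounds on a say |a g - s| <= r with
    r^2 = s^2 + c g; this is (a g - s)^2 <= r^2, which is the conclusion
    multiplied by g. *)
Lemma quadratic_le (R : realType) (a s g c : R) : 0 < g -> 0 <= c ->
  (s - Num.sqrt (s ^+ 2 + c * g)) / g <= a
    <= (s + Num.sqrt (s ^+ 2 + c * g)) / g ->
  a ^+ 2 * g - 2 * a * s <= c.
Proof.
move=> g0 c0; rewrite ler_pdivrMr// ler_pdivlMr//.
set r := Num.sqrt _ => /andP[lo hi].
have rr : r ^+ 2 = s ^+ 2 + c * g.
  by rewrite sqr_sqrtr// addr_ge0 ?sqr_ge0// mulr_ge0// ltW.
have : 0 <= (r - (a * g - s)) * (r + (a * g - s)) by apply: mulr_ge0; lra.
by move=> ag; rewrite -(ler_pM2r g0); lra.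
Qed.

(** u^T G u is the inner product of G u and u, so neither vector can vanish; all
    the divisions by u^T u and by the Rayleigh quotient of G^T G are then
    legitimate. *)
Lemma rayleigh_gram_gt0 (R : realType) n (G : 'M[R]_n) (u : 'rV[R]_n) :
  quadform G u != 0 -> 0 < dotv u u /\ 0 < rayleigh (G^T *m G) u.
Proof.
move=> Gu0; have uu0 : 0 < dotv u u.
  rewrite lt_def dotv_ge0 andbT; apply: contraNneq Gu0 => /dotv_eq0 ->.
  by rewrite /quadform !mul0mx mxE.
split=> //; rewrite divr_gt0// quadform_gram lt_def dotv_ge0 andbT.
apply: contraNneq Gu0 => /dotv_eq0 uG0.
by rewrite -dotv_mul_tr uG0 /dotv mul0mx mxE.
Qed.

(** Here u stands for the current residual, v for the one after the step - a u,
    and a carries the sign of the step: a single statement covers both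
    directions. *)
Lemma residual_bounds (R : realType) n (G : 'M[R]_n) (u : 'rV[R]_n)
    (a eta : R) :
  quadform G u != 0 -> 0 < eta ->
  let s := rayleigh (sympart G) u in
  let g := rayleigh (G^T *m G) u in
  let Delta := s ^+ 2 + (eta ^+ 2 + 2 * eta) * g in
  let v := u - a *: (u *m G^T) in
  (0 < a * s -> `|a| < 2 * (`|s| / g) -> enorm v < enorm u) /\
  ((s - Num.sqrt Delta) / g <= a <= (s + Num.sqrt Delta) / g ->
     enorm v <= (1 + eta) * enorm u).
Proof.
move=> Gu0 eta0 s g Delta v.
have [uu0 g0] := rayleigh_gram_gt0 Gu0.
have vvE : dotv v v = dotv u u * (1 + (a ^+ 2 * g - 2 * a * s)).
  rewrite /v dotv_subZ dotv_mul_tr -quadform_gram /g /s /rayleigh.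
  by rewrite quadform_sympart; field; rewrite gt_eqF.
split=> [as0 alt | abounds].
  rewrite /enorm ltr_sqrt// vvE gtr_pMr// gtrDl.
  exact: quadratic_lt0.
have c0 : 0 <= eta ^+ 2 + 2 * eta by nra.
have := quadratic_le g0 c0 abounds.
have -> : (1 + eta) * enorm u = Num.sqrt ((1 + eta) ^+ 2 * dotv u u).
  by rewrite sqrtrM ?sqr_ge0// sqrtr_sqr ger0_norm// addr_ge0// ltW.
move=> h; rewrite /enorm ler_wsqrtr// vvE mulrC ler_wpM2r ?dotv_ge0//.
have -> : (1 + eta) ^+ 2 = 1 + (eta ^+ 2 + 2 * eta) by ring.
by rewrite lerD2l.
Qed.

Unset Implicit Arguments.
Set Strict Implicit.

Theorem theorem4p3 (R : realType) (n : nat) (F : 'rV[R]_n -> 'rV[R]_n)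
    (xprev x : 'rV[R]_n) (beta gamma eta : R)
    (beta_neq0 : beta != 0) (gamma_gt0 : 0 < gamma) (gamma_le1 : gamma <= 1)
    (eta_gt0 : 0 < eta)
    (pprev yprev : 'rV[R]_n)
    (pprevE : pprev = x - xprev) (yprevE : yprev = F x - F xprev)
    (bb1_def : dotv pprev yprev != 0) (bb2_def : dotv yprev yprev != 0)
    (bb1_neq0 : bb1 pprev yprev != 0) (bb2_neq0 : bb2 pprev yprev != 0)
    (p : 'rV[R]_n) (D : set 'rV[R]_n)
    (D_open : open D) (D_convex : convex_set D)
    (segD : forall t : R, 0 <= t <= 1 -> D (x + t *: p))
    (F_C1 : continuously_differentiable_on F D)
    (J_neq0 : quadform (jacmx F x) (F x) != 0)
    (G_neq0 : quadform (avgjac F x p) (F x) != 0) :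
  let qS := rayleigh (avgjacS F x p) (F x) in
  let qGG := rayleigh ((avgjac F x p)^T *m avgjac F x p) (F x) in
  let Delta := qS ^+ 2 + (eta ^+ 2 + 2 * eta) * qGG in
  (p = - (gamma * beta) *: F x ->
     (0 < beta * qS -> gamma * `|beta| < 2 * (`|qS| / qGG) ->
        enorm (F (x + p)) < enorm (F x)) /\
     ((qS - Num.sqrt Delta) / qGG <= gamma * beta
        <= (qS + Num.sqrt Delta) / qGG ->
        enorm (F (x + p)) <= (1 + eta) * enorm (F x))) /\
  (p = (gamma * beta) *: F x ->
     (beta * qS < 0 -> gamma * `|beta| < 2 * (`|qS| / qGG) ->
        enorm (F (x + p)) < enorm (F x)) /\
     ((- qS - Num.sqrt Delta) / qGG <= gamma * beta
        <= (- qS + Num.sqrt Delta) / qGG ->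
        enorm (F (x + p)) <= (1 + eta) * enorm (F x))).
Proof.
have [dF cJ] := F_C1.
move=> qS qGG Delta.
have qSE : qS = rayleigh (sympart (avgjac F x p)) (F x).
  by rewrite /qS (avgjacS_sympart D_open segD cJ).
have FpE a : p = - a *: F x ->
    F (x + p) = F x - a *: (F x *m (avgjac F x p)^T).
  move=> pE; rewrite -[LHS](subrK (F x)) (mean_value_avgjac D_open segD F_C1).
  by rewrite [X in X *m _]pE scaleNr mulNmx -scalemxAl addrC.
split=> pE; [have := FpE (gamma * beta) pE | have := FpE (- (gamma * beta))].
- move=> ->.
  have [] := residual_bounds (gamma * beta) G_neq0 eta_gt0.
  rewrite -qSE -/qGG -/Delta normrM (gtr0_norm gamma_gt0) => dec inc.
  by split=> // bS; apply: dec; rewrite -mulrA mulr_gt0.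
rewrite opprK => /(_ pE) ->.
have [] := residual_bounds (- (gamma * beta)) G_neq0 eta_gt0.
rewrite -qSE -/qGG -/Delta normrN normrM (gtr0_norm gamma_gt0) => dec inc.
split=> [bS | /andP[lo hi]].
  by apply: dec; rewrite mulNr -mulrA oppr_gt0 pmulr_rlt0.
apply: inc; rewrite lerNr lerNl -!mulNr !opprD !opprK.
by apply/andP; split.
Qed.
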